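(* Suppose that for each $i=1,2,\ldots,p$ the function $x\mapsto f(x,\zeta_i)$ is continuous on $\mathcal{X}$. Then the GOWA robust objective function $$\phi(x)=\left(\sum_{i=1}^{p}w_i\,(s_i(x))^{\lambda}\right)^{1/\lambda},\qquad x\in\mathcal{X},$$ is continuous on $\mathcal{X}$.
   Context: Setting: $\Omega=\{\zeta_1,\ldots,\zeta_p\}\subseteq\mathbb{R}^m$ is a finite (ordered) uncertainty set, $\mathcal{X}\subseteq\mathbb{R}^n$ is a compact feasible set independent of $\Omega$, and $f:\mathcal{X}\times\Omega\to\mathbb{R}$ satisfies $f(x,\zeta)\ge 0$ for all $x\in\mathcal{X}$, $\zeta\in\Omega$. The uncertain single objective optimization problem $\mathcal{P}(\Omega)$ is the family of problems $\min_{x\in\mathcal{X}} f(x,\zeta)$, $\zeta\in\Omega$. Auxiliary functions $s_1,\ldots,s_p:\mathcal{X}\to\mathbb{R}$: for each $x$, recursively for $i=1,\ldots,p$, let $j_i(x)$ be the smallest index among those $j\in\{1,\ldots,p\}\setminus\{j_1(x),\ldots,j_{i-1}(x)\}$ at which $f(x,\zeta_j)$ is maximal over that remaining index set, and put $s_i(x)=f(x,\zeta_{j_i(x)})$. Thus exactly one index is removed at each step, so $s_i(x)$ is the $i$-th largest of the values $f(x,\zeta_1),\ldots,f(x,\zeta_p)$ counted with multiplicity; $s_1(x)\ge s_2(x)\ge\cdots\ge s_p(x)$. Parameters: a real $\lambda>0$ and weights $w_i\ge 0$, $i=1,\ldots,p$, with $\sum_{i=1}^p w_i=1$, all given. *)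

(* Defs.v *)
From mathcomp Require Import all_boot all_order all_algebra.
From mathcomp Require Import all_classical all_reals all_analysis.

Set Implicit Arguments.
Unset Strict Implicit.
Unset Printing Implicit Defensive.

Import Order.TTheory GRing.Theory Num.Theory.

Local Open Scope ring_scope.

(* [a j] stands for f(x, zeta_j) at a fixed x.  [enum 'I_p] is increasing, so
   the head of [maximisers a J] is the smallest index outside [J] at which [a]
   is maximal over the complement of [J]. *)
Definition maximisers (R : realType) (p : nat) (a : 'I_p -> R)
    (J : seq 'I_p) : seq 'I_p :=
  [seq j <- enum 'I_p |
    (j \notin J) && [forall k, (k \notin J) ==> (a k <= a j)]].

(* The indices removed during the first [k] steps, in order. *)
Fixpoint removed (R : realType) (p : nat) (a : 'I_p -> R) (k : nat) :
    seq 'I_p :=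
  if k is k'.+1 then
    removed a k' ++ take 1 (maximisers a (removed a k'))
  else [::].

(* Steps are counted from 0.  The default [i] of [head] is never returned, see
   [maximisers_neq_nil]. *)
Definition sel_index (R : realType) (p : nat) (a : 'I_p -> R) (i : 'I_p) :
    'I_p :=
  head i (maximisers a (removed a i)).

Definition ordered_value (R : realType) (n m p : nat) (zeta : 'I_p -> 'rV[R]_m)
    (f : 'rV[R]_n -> 'rV[R]_m -> R) (i : 'I_p) (x : 'rV[R]_n) : R :=
  f x (zeta (sel_index (fun j => f x (zeta j)) i)).

Definition gowa (R : realType) (n m p : nat) (zeta : 'I_p -> 'rV[R]_m)
    (f : 'rV[R]_n -> 'rV[R]_m -> R) (lambda : R) (w : 'I_p -> R)
    (x : 'rV[R]_n) : R :=
  (\sum_(i < p) w i * (ordered_value zeta f i x `^ lambda)) `^ lambda^-1.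

Lemma size_removed (R : realType) (p : nat) (a : 'I_p -> R) (k : nat) :
  (size (removed a k) <= k)%N.
Proof.
elim: k => //= k IHk; rewrite size_cat -(addn1 k).
by apply: leq_add => //; rewrite size_take; case: ltnP.
Qed.

Lemma maximisers_neq_nil (R : realType) (p : nat) (a : 'I_p -> R) (i : 'I_p) :
  maximisers a (removed a i) != [::].
Proof.
set J := removed a i.
have [j0 j0J] : exists j, j \notin J.
  apply/existsP; rewrite -negb_forall; apply/negP => /forallP allJ.
  have : (#|'I_p| <= size J)%N.
    by rewrite cardE uniq_leq_size ?enum_uniq // => j _; exact: allJ.
  by rewrite card_ord leqNgt (leq_ltn_trans (size_removed a i)).
case: (@arg_maxP _ _ _ j0 [pred j | j \notin J] a j0J) => j jJ jmax.
rewrite -has_filter; apply/hasP; exists j; first by rewrite mem_enum.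
by rewrite [_ \notin _]jJ /=; apply/forallP => k; apply/implyP => /jmax.
Qed.

(* Main.v *)
Require Import Defs.
From mathcomp Require Import all_boot all_order all_algebra.
From mathcomp Require Import all_classical all_reals all_analysis.
From mathcomp Require Import lra.

Import Order.TTheory GRing.Theory Num.Theory.
Import numFieldNormedType.Exports.

Local Open Scope classical_set_scope.
Local Open Scope ring_scope.

(** The index selected at each step may jump as [x] moves, because ties and
    crossings change which scenario is the worst one; the selected value does
    not.  For a fixed vector [a] of values, a real [t] is at most the [i]-th
    selected value exactly when enough entries of [a] are at least [t]
    ([le_sel_indexE]), a condition in which no selected index appears.  If two
    vectors are uniformly within [e] of each other, every entry of one that is
    at least [t] corresponds to an entry of the other that is at least [t - e],
    so counting shows that the selected values are also within [e]
    ([sel_index_dist_le]): order statistics are 1-Lipschitz for the sup norm.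
    Since there are finitely many scenarios, continuity of each
    [x |-> f x (zeta j)] gives uniform closeness in [j], hence continuity of
    each ordered value.

    What remains is to compose with powers.  The function [y |-> y `^ r] with
    [0 < r] is discontinuous at [0] from the left, as [y `^ r = 1] for
    [y < 0]; so the limits are taken along the filter of neighbourhoods of a
    point within [X], on which both the ordered values and the weighted sum are
    nonnegative ([cvg_powR_ge0]). *)

(** Each step removes exactly one index, the candidate set being nonempty as
    long as fewer than [p] indices are gone. *)
Lemma removedS {R : realType} {p : nat} (a : 'I_p -> R) (i : 'I_p) :
  removed a i.+1 = rcons (removed a i) (sel_index a i).
Proof.
rewrite /= /sel_index; have := maximisers_neq_nil a i.
by case: maximisers => [//|j s] _ /=; rewrite take0 cats1.
Qed.

Lemma sel_indexP {R : realType} {p : nat} (a : 'I_p -> R) (i : 'I_p) :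
  sel_index a i \notin removed a i /\
  forall k, k \notin removed a i -> a k <= a (sel_index a i).
Proof.
have : sel_index a i \in maximisers a (removed a i).
  rewrite /sel_index; have := maximisers_neq_nil a i.
  by case: maximisers => [//|j s] _; rewrite mem_head.
rewrite mem_filter => /andP[/andP[selJ /forallP selmax] _]; split=> // k kJ.
exact: implyP (selmax k) kJ.
Qed.

(** Greedy removal of maxima keeps the removed values above the remaining ones:
    a newly removed index dominates what is left by its choice, and an old one
    already dominated a larger remainder. *)
Lemma removed_greedy {R : realType} {p : nat} (a : 'I_p -> R) (k : nat) :
  (k <= p)%N ->
  [/\ uniq (removed a k), size (removed a k) = k
    & {in removed a k, forall j l, l \notin removed a k -> a l <= a j}].
Proof.
elim: k => [//|k IHk] ltkp; have [uJ sJ domJ] := IHk (ltnW ltkp).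
pose i := Ordinal ltkp; have [selJ selmax] := sel_indexP a i.
rewrite (removedS a i) rcons_uniq size_rcons selJ uJ sJ; split=> // j + l.
rewrite !mem_rcons !inE negb_or => /predU1P[->|jJ] /andP[_ lJ].
  exact: selmax.
exact: domJ.
Qed.

(** Order statistics by counting.  The [i.+1] indices removed up to and including
    step [i] carry values at least the selected one.  Conversely, steps being
    counted from [0], any value above the selected one sits at one of the [i]
    indices removed before. *)
Lemma le_sel_indexE {R : realType} {p : nat} (a : 'I_p -> R) (i : 'I_p)
    (t : R) :
  (t <= a (sel_index a i)) = (i < #|[set j | (t <= a j)%R]%SET|)%N.
Proof.
have [uJ sJ domJ] := removed_greedy a i (ltnW (ltn_ord i)).
have [selJ selmax] := sel_indexP a i.
apply/idP/idP => [tle|].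
  have uJs : uniq (rcons (removed a i) (sel_index a i)).
    by rewrite rcons_uniq selJ.
  rewrite -[X in (X < _)%N]sJ -(size_rcons _ (sel_index a i)) -(card_uniqP uJs).
  apply/subset_leq_card/fintype.subsetP => j; rewrite mem_rcons !inE.
  move=> /predU1P[->//|jJ]; exact: le_trans tle (domJ _ jJ _ selJ).
rewrite ltnNge => /negP card_gt; rewrite leNgt; apply/negP => lt_t.
apply: card_gt; rewrite -[X in (_ <= X)%N]sJ -(card_uniqP uJ).
apply/subset_leq_card/fintype.subsetP => j; rewrite inE => tj.
apply/negPn/negP => /selmax; rewrite leNgt => /negP; apply.
exact: lt_le_trans lt_t tj.
Qed.

(** The selected indices for [a] and [b] may be unrelated, so the values cannot
    be compared index by index; the comparison goes through the counting
    criterion with threshold the selected value of one vector minus [e]. *)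
Lemma sel_index_dist_le {R : realType} {p : nat} (a b : 'I_p -> R) (i : 'I_p)
    (e : R) :
  (forall j, `|a j - b j| <= e) ->
  `|a (sel_index a i) - b (sel_index b i)| <= e.
Proof.
move=> abe.
have half (c d : 'I_p -> R) : (forall j, c j - d j <= e) ->
    c (sel_index c i) - e <= d (sel_index d i).
  move=> cde; rewrite le_sel_indexE.
  have : (i < #|[set j | (c (sel_index c i) <= c j)%R]%SET|)%N.
    by rewrite -le_sel_indexE.
  move=> /leq_trans; apply; apply/subset_leq_card/fintype.subsetP => j.
  rewrite !inE => cj; have := cde j; lra.
have ab j : - e <= a j - b j <= e by rewrite -ler_norml.
have := half a b (fun j => proj2 (andP (ab j))).
have /(half b a) : forall j, b j - a j <= e.
  by move=> j; have /andP[] := ab j; lra.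
by rewrite ler_norml => ? ?; apply/andP; split; lra.
Qed.

Lemma cvg_sel_index {R : realType} {p : nat} {T : Type} {F : set_system T}
    {FF : Filter F} (a : T -> 'I_p -> R) (b : 'I_p -> R) (i : 'I_p) :
  (forall j, a t j @[t --> F] --> b j) ->
  a t (sel_index (a t) i) @[t --> F] --> b (sel_index b i).
Proof.
move=> ab; apply/cvgrPdist_le => e e0.
have : \forall t \near F, forall j, `|b j - a t j| <= e.
  by apply: filter_forall => j; move/cvgrPdist_le : (ab j); exact.
by apply: filterS => t; exact: sel_index_dist_le.
Qed.

(** Nonnegativity along the filter is essential when [l = 0], since negative
    numbers have power [1]; there monotonicity of the power gives the bound.
    For [0 < l] the power is differentiable at [l]. *)
Lemma cvg_powR_ge0 {R : realType} {T : Type} {F : set_system T}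
    {FF : Filter F} (g : T -> R) (l r : R) :
  0 < r -> (\forall t \near F, 0 <= g t) -> 0 <= l ->
  g t @[t --> F] --> l -> g t `^ r @[t --> F] --> l `^ r.
Proof.
move=> r0 g0; rewrite le_eqVlt => /predU1P[<-|l0] gl.
  rewrite powR0 ?gt_eqF//; apply/cvgrPdist_lt => e e0.
  have d0 : 0 < e `^ r^-1 by exact: powR_gt0.
  move/cvgrPdist_lt : gl => /(_ _ d0); apply: filterS2 g0 => t g0.
  rewrite !sub0r !normrN !ger0_norm ?powR_ge0// => gd.
  have -> : e = (e `^ r^-1) `^ r.
    by rewrite -powRrM mulVf ?gt_eqF// powRr1// ltW.
  by apply: gt0_ltr_powR => //; rewrite nnegrE// powR_ge0.
suff c : {for l, continuous (fun y : R => y `^ r)}.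
  exact: (continuous_cvg FF c gl).
apply/differentiable_continuous/derivable1_diffP/derivable_powR.
by rewrite in_itv/= l0.
Qed.

Theorem theorem3p5 (R : realType) (n m p : nat)
    (zeta : 'I_p -> 'rV[R]_m) (X : set 'rV[R]_n)
    (f : 'rV[R]_n -> 'rV[R]_m -> R) (lambda : R) (w : 'I_p -> R)
    (X_compact : compact X)
    (f_ge0 : forall x, X x -> forall i : 'I_p, 0 <= f x (zeta i))
    (lambda_gt0 : 0 < lambda)
    (w_ge0 : forall i, 0 <= w i)
    (w_sum1 : \sum_(i < p) w i = 1)
    (f_continuous : forall i : 'I_p, {within X, continuous (fun x => f x (zeta i))}) :
  {within X, continuous (gowa zeta f lambda w)}.
Proof.
apply/subspace_continuousP => x Xx; rewrite /gowa /=.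
have s_ge0 y i : X y -> 0 <= ordered_value zeta f i y.
  by move=> Xy; exact: f_ge0.
have sum_ge0 y : 0 <= \sum_(i < p) w i * ordered_value zeta f i y `^ lambda.
  by apply: sumr_ge0 => i _; rewrite mulr_ge0// powR_ge0.
apply: cvg_powR_ge0; rewrite ?invr_gt0//; first exact: nearW.
apply: (cvg_big (@add_continuous R)) => i _.
apply: cvgM; first exact: cvg_cst.
apply: cvg_powR_ge0 => //; last 2 first.
- exact: s_ge0.
- apply: (cvg_sel_index (fun y j => f y (zeta j))
                         (fun j => f x (zeta j))) => j.
  by have /subspace_continuousP := f_continuous j; exact.
by apply: filterS (near_withinT X _) => y; exact: s_ge0.
Qed.
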